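(* Let $\lambda_1>0$. For any vector $y\in\mathbb{R}^n$ and any matrix $X\in\mathbb{R}^{n\times p}$, let $\hat\beta^{\lambda_1}$ be a Lasso solution with parameter $\lambda_1$ and let $\hat\beta^{\mathrm{SLS}}$ be an associated Sign-Least-Squares Lasso refitting. Then there exists $\lambda_0>0$ such that for any $\lambda_2\ge\lambda_0$ the solution of the Bregman Lasso refitting problem with parameters $\lambda_1,\lambda_2$ is given by $\hat\beta^{\lambda_1,\lambda_2}=\hat\beta^{\mathrm{SLS}}$, i.e. $\hat\beta^{\mathrm{SLS}}$ is a minimizer of $$\beta\mapsto\frac1{2n}\|y-X\beta\|_2^2+\lambda_2D^{\hat\rho^{\lambda_1}}(\beta,\hat\beta^{\lambda_1})\quad\text{over }\mathbb{R}^p .$$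
   Context: A Lasso solution with parameter $\lambda_1>0$ is any $\hat\beta^{\lambda_1}\in\arg\min_{\beta\in\mathbb{R}^p}\frac{1}{2n}\|y-X\beta\|_2^2+\lambda_1\|\beta\|_1$. Put $\hat\rho^{\lambda_1}=\frac{1}{\lambda_1n}X^\top(y-X\hat\beta^{\lambda_1})$, which is a subgradient of $\|\cdot\|_1$ at $\hat\beta^{\lambda_1}$. The Bregman divergence of the $\ell_1$-norm is $D^{\rho}(z,w)=\|z\|_1-\|w\|_1-\langle\rho,z-w\rangle$ for $\rho\in\partial\|w\|_1$. A Bregman Lasso refitting is any $\hat\beta^{\lambda_1,\lambda_2}\in\arg\min_{\beta\in\mathbb{R}^p}\frac{1}{2n}\|y-X\beta\|_2^2+\lambda_2D^{\hat\rho^{\lambda_1}}(\beta,\hat\beta^{\lambda_1})$. The equicorrelation set is $E=\{j\in\{1,\dots,p\}:|\hat\rho^{\lambda_1}_j|=1\}$, with complement $E^c$. For a set of indices $E$, $X_E$ is the submatrix of $X$ with columns in $E$ and $\beta_E$ the corresponding subvector; $\odot$ is the entrywise product. A Sign-Least-Squares Lasso refitting is any $\hat\beta^{\mathrm{SLS}}\in\mathbb{R}^p$ with $\hat\beta^{\mathrm{SLS}}_{E^c}=0$ and $\hat\beta^{\mathrm{SLS}}_E\in\arg\min\{\frac1{2n}\|y-X_E\beta_E\|_2^2:\ \beta_E\in\mathbb{R}^{|E|},\ \hat\rho^{\lambda_1}_E\odot\beta_E\ge0\}$ (entrywise inequality). *)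

(* Defs.v *)
From HB Require Import structures.
From mathcomp Require Import all_boot all_order all_algebra.
From mathcomp Require Import classical_sets reals.

Set Implicit Arguments.
Unset Strict Implicit.
Unset Printing Implicit Defensive.

Import Order.TTheory GRing.Theory Num.Theory.
Local Open Scope classical_set_scope.
Local Open Scope ring_scope.

Definition argmin (R : realType) (T : Type) (A : set T) (f : T -> R) : set T :=
  [set x | A x /\ forall z, A z -> f x <= f z].

Definition norm1 (R : realType) (m : nat) (v : 'cV[R]_m) : R :=
  \sum_(i < m) `|v i 0|.

Definition norm2 (R : realType) (m : nat) (v : 'cV[R]_m) : R :=
  Num.sqrt (\sum_(i < m) v i 0 ^+ 2).

Definition inner (R : realType) (m : nat) (u v : 'cV[R]_m) : R :=
  \sum_(i < m) u i 0 * v i 0.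

Definition least_squares (R : realType) (n q : nat)
    (X : 'M[R]_(n, q)) (y : 'cV[R]_n) (b : 'cV[R]_q) : R :=
  (2 * n%:R)^-1 * norm2 (y - X *m b) ^+ 2.

Definition lasso_solution (R : realType) (n p : nat)
    (X : 'M[R]_(n, p)) (y : 'cV[R]_n) (lambda1 : R) : set 'cV[R]_p :=
  argmin setT (fun b => least_squares X y b + lambda1 * norm1 b).

Definition lasso_subgradient (R : realType) (n p : nat)
    (X : 'M[R]_(n, p)) (y : 'cV[R]_n) (lambda1 : R) (bhat : 'cV[R]_p) :
    'cV[R]_p :=
  (lambda1 * n%:R)^-1 *: (X^T *m (y - X *m bhat)).

(* Total in rho; it is the Bregman divergence of norm1 when rho is a
   subgradient of norm1 at w. *)
Definition bregman_div (R : realType) (p : nat) (rho z w : 'cV[R]_p) : R :=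
  norm1 z - norm1 w - inner rho (z - w).

Definition bregman_refitting (R : realType) (n p : nat)
    (X : 'M[R]_(n, p)) (y : 'cV[R]_n) (lambda1 lambda2 : R)
    (bhat : 'cV[R]_p) : set 'cV[R]_p :=
  let rho := lasso_subgradient X y lambda1 bhat in
  argmin setT
    (fun b => least_squares X y b + lambda2 * bregman_div rho b bhat).

Definition equicorrelation (R : realType) (p : nat) (rho : 'cV[R]_p) :
    {set 'I_p} :=
  [set j | `|rho j 0| == 1]%SET.

(* X_E and b_E: indices in E are listed by enum_val : 'I_#|E| -> 'I_p. *)
Definition subcols (R : realType) (n p : nat) (E : {set 'I_p})
    (X : 'M[R]_(n, p)) : 'M[R]_(n, #|E|) :=
  colsub (@enum_val _ (mem E)) X.

Definition subvec (R : realType) (p : nat) (E : {set 'I_p})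
    (b : 'cV[R]_p) : 'cV[R]_#|E| :=
  rowsub (@enum_val _ (mem E)) b.

Definition sls_refitting (R : realType) (n p : nat)
    (X : 'M[R]_(n, p)) (y : 'cV[R]_n) (lambda1 : R) (bhat : 'cV[R]_p) :
    set 'cV[R]_p :=
  let rho := lasso_subgradient X y lambda1 bhat in
  let E := equicorrelation rho in
  [set b : 'cV[R]_p | (forall j, j \notin E -> b j 0 = 0) /\
           argmin [set c : 'cV[R]_#|E| |
                     forall k, 0 <= subvec E rho k 0 * c k 0]
                  (least_squares (subcols E X) y)
                  (subvec E b)].

(* Main.v *)
(** The gradient [g] of the least-squares term at the SLS refitting [s] satisfies
    the first-order conditions [rho_j g_j >= 0] and [g_j s_j = 0] for [j] in [E].
    The part [sum_j (|b_j| - rho_j b_j)] of the Bregman divergence that depends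
    on [b] is nonnegative, because the Lasso optimality gives [|rho_j| <= 1], and
    it vanishes at [s].  By convexity it is then enough that
    [g_j (b_j - s_j) + lambda2 (|b_j| - rho_j b_j) >= 0] for every [j], which
    holds once [lambda2 >= |g_j|] on [E] and [lambda2 (1 - |rho_j|) >= |g_j|]
    off [E]: finitely many lower bounds on [lambda2]. *)
Require Import Defs.
From mathcomp Require Import all_boot all_order all_algebra.
From mathcomp Require Import classical_sets reals.
From mathcomp Require Import ring lra.
Set Implicit Arguments.
Unset Strict Implicit.
Unset Printing Implicit Defensive.

Import Order.TTheory GRing.Theory Num.Theory.
Local Open Scope ring_scope.

(** * Second-order expansion of the least-squares term *)

Lemma norm2_sqr (R : realType) (m : nat) (v : 'cV[R]_m) :
  norm2 v ^+ 2 = inner v v.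
Proof.
by rewrite /norm2 sqr_sqrtr // sumr_ge0 // => i _; rewrite sqr_ge0.
Qed.

Lemma inner_self_ge0 (R : realType) (m : nat) (v : 'cV[R]_m) : 0 <= inner v v.
Proof. by rewrite -norm2_sqr sqr_ge0. Qed.

Lemma inner_trmx_mul (R : realType) (n p : nat) (X : 'M[R]_(n, p))
    (r : 'cV[R]_n) (d : 'cV[R]_p) : inner (X^T *m r) d = inner r (X *m d).
Proof.
rewrite /inner; under eq_bigr do rewrite mxE mulr_suml.
rewrite exchange_big; apply: eq_bigr => i _ /=.
by rewrite mxE mulr_sumr; apply: eq_bigr => j _; rewrite mxE; ring.
Qed.

Lemma inner_scale_delta (R : realType) (m : nat) (u : 'cV[R]_m) (j : 'I_m)
    (t : R) : inner u (t *: delta_mx j 0) = u j 0 * t.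
Proof.
rewrite /inner (bigD1 j) //= big1 ?addr0 => [|i /negPf ij].
  by rewrite !mxE !eqxx mulr1.
by rewrite !mxE ij mulr0 mulr0.
Qed.

Definition least_squares_grad (R : realType) (n p : nat) (X : 'M[R]_(n, p))
    (y : 'cV[R]_n) (b : 'cV[R]_p) : 'cV[R]_p :=
  - (n%:R^-1 *: (X^T *m (y - X *m b))).

Lemma least_squares_expand (R : realType) (n p : nat) (X : 'M[R]_(n, p))
    (y : 'cV[R]_n) (b d : 'cV[R]_p) :
  least_squares X y (b + d) =
    least_squares X y b + inner (least_squares_grad X y b) d
      + (2 * n%:R)^-1 * inner (X *m d) (X *m d).
Proof.
have -> : inner (least_squares_grad X y b) d =
    - n%:R^-1 * inner (y - X *m b) (X *m d).
  rewrite -inner_trmx_mul /inner mulr_sumr.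
  by apply: eq_bigr => i _; rewrite 2!mxE; ring.
rewrite /least_squares !norm2_sqr mulmxDr opprD addrA.
move: (y - X *m b) (X *m d) => r w.
have -> : inner (r - w) (r - w) = inner r r - 2 * inner r w + inner w w.
  rewrite /inner mulr_sumr -sumrB -big_split /=.
  by apply: eq_bigr => i _; rewrite !mxE; ring.
(* Generalizing [n%:R^-1] to an arbitrary scalar covers [n = 0] as well, where this inverse is
   [0]. *)
by rewrite invfM; move: (n%:R^-1) => k; field.
Qed.

Lemma least_squares_gradient_le (R : realType) (n p : nat) (X : 'M[R]_(n, p))
    (y : 'cV[R]_n) (b d : 'cV[R]_p) :
  least_squares X y b + inner (least_squares_grad X y b) d
    <= least_squares X y (b + d).
Proof.
rewrite least_squares_expand lerDl mulr_ge0 ?inner_self_ge0 //.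
by rewrite invr_ge0 mulr_ge0.
Qed.

(** Used for first-order conditions along a coordinate axis, where only the linear coefficient
    matters; the curvature [c] is left unspecified. *)
Lemma least_squares_expand_delta (R : realType) (n p : nat)
    (X : 'M[R]_(n, p)) (y : 'cV[R]_n) (b : 'cV[R]_p) (j : 'I_p) :
  exists c : R, forall t : R,
    least_squares X y (b + t *: delta_mx j 0) =
      least_squares X y b + least_squares_grad X y b j 0 * t + c * t ^+ 2.
Proof.
pose e : 'cV[R]_p := delta_mx j 0.
exists ((2 * n%:R)^-1 * inner (X *m e) (X *m e)) => t.
rewrite least_squares_expand inner_scale_delta -scalemxAr; congr (_ + _).
rewrite -mulrA; congr (_ * _); rewrite /inner mulr_suml.
by apply: eq_bigr => i _; rewrite !mxE; ring.
Qed.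

(** * Bound on the Lasso subgradient *)

Lemma linear_coef_ge0 (R : realType) (a c : R) :
  (forall t, 0 < t -> t <= 1 -> 0 <= a * t + c * t ^+ 2) -> 0 <= a.
Proof.
move=> H; rewrite leNgt; apply/negP => a0.
have D0 : 0 < `|c| - a + 1 by have := normr_ge0 c; lra.
(* This step size lies in [(0, 1]] and gives [a + |c| t = (a - 1) t < 0], so the quadratic would be
   negative at [t]. *)
pose t := - a / (`|c| - a + 1).
have tD : t * (`|c| - a + 1) = - a by rewrite /t mulfVK // gt_eqF.
have t0 : 0 < t by rewrite divr_gt0 // oppr_gt0.
have t1 : t <= 1 by rewrite ler_pdivrMr // mul1r; have := normr_ge0 c; lra.
have := H t t0 t1; rewrite leNgt => /negP; apply.
have -> : a * t + c * t ^+ 2 = (a + c * t) * t by ring.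
rewrite pmulr_llt0 //.
have := ler_wpM2r (ltW t0) (ler_norm c).
have : a * t < 0 by rewrite nmulr_rlt0.
lra.
Qed.

Lemma norm1_add_delta_le (R : realType) (m : nat) (b : 'cV[R]_m) (j : 'I_m)
    (t : R) : norm1 (b + t *: delta_mx j 0) <= norm1 b + `|t|.
Proof.
rewrite /norm1 (bigD1 j) //= [leRHS](_ : _ =
  `|b j 0| + `|t| + \sum_(i < m | i != j) `|b i 0|); last first.
  by rewrite (bigD1 j) //= addrAC.
apply: lerD; first by rewrite !mxE !eqxx mulr1 ler_normD.
by apply: ler_sum => i /negPf ij; rewrite !mxE ij mulr0 addr0.
Qed.

Lemma lasso_subgradient_grad (R : realType) (n p : nat) (X : 'M[R]_(n, p))
    (y : 'cV[R]_n) (lambda1 : R) (b : 'cV[R]_p) (j : 'I_p) :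
  lambda1 != 0 ->
  least_squares_grad X y b j 0 =
    - (lambda1 * lasso_subgradient X y lambda1 b j 0).
Proof.
rewrite /least_squares_grad /lasso_subgradient => l0.
move: (X^T *m _) => v; rewrite !mxE invfM; congr (- _).
by rewrite !mulrA mulfV // mul1r.
Qed.

(** Moving [bhat] by [t] along axis [j] raises the objective by at most
    [g_j t + c t^2 + lambda1 |t|], with [g_j = - lambda1 rho_j]. Optimality makes this nonnegative;
    small [t] of either sign bounds [rho_j] on both sides. *)
Lemma lasso_subgradient_le1 (R : realType) (n p : nat) (X : 'M[R]_(n, p))
    (y : 'cV[R]_n) (lambda1 : R) (bhat : 'cV[R]_p) (j : 'I_p) :
  0 < lambda1 -> lasso_solution X y lambda1 bhat ->
  `|lasso_subgradient X y lambda1 bhat j 0| <= 1.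
Proof.
move=> l0 [_ opt]; have [c Hc] := least_squares_expand_delta X y bhat j.
have {}opt (t : R) : 0 <= least_squares_grad X y bhat j 0 * t + c * t ^+ 2
    + lambda1 * `|t|.
  have := opt (bhat + t *: delta_mx j 0) I; rewrite Hc.
  have := norm1_add_delta_le bhat j t; nra.
rewrite (@lasso_subgradient_grad _ _ _ _ _ lambda1) ?gt_eqF // in opt.
set r := lasso_subgradient _ _ _ _ _ _ in opt *.
have r1 : 0 <= lambda1 * (1 - r).
  by apply: (@linear_coef_ge0 _ _ c) => t t0 _; have := opt t;
    rewrite gtr0_norm //; lra.
have r2 : 0 <= lambda1 * (1 + r).
  apply: (@linear_coef_ge0 _ _ c) => t t0 _; have := opt (- t).
  by rewrite normrN gtr0_norm // sqrrN; lra.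
move: r1 r2; rewrite !pmulr_rge0 // => r1 r2.
by rewrite ler_norml; apply/andP; split; lra.
Qed.

(** * First-order conditions at the SLS refitting *)

Lemma subcols_mul_subvec (R : realType) (n p : nat) (E : {set 'I_p})
    (X : 'M[R]_(n, p)) (b : 'cV[R]_p) :
  (forall j, j \notin E -> b j 0 = 0) ->
  subcols E X *m subvec E b = X *m b.
Proof.
move=> b0; apply/colP => i; rewrite !mxE.
rewrite [RHS](bigID (mem E)) /= [X in _ + X]big1 ?addr0 => [|j jE]; last first.
  by rewrite b0 // mulr0.
by rewrite [RHS]big_enum_val /=; apply: eq_bigr => k _; rewrite !mxE.
Qed.

(** Transports the minimality from ['cV_#|E|] to vectors of the full space supported in [E], so that
    perturbations can be written in the original coordinates. *)
Lemma sls_refitting_min (R : realType) (n p : nat) (X : 'M[R]_(n, p))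
    (y : 'cV[R]_n) (lambda1 : R) (bhat s b : 'cV[R]_p) :
  let rho := lasso_subgradient X y lambda1 bhat in
  sls_refitting X y lambda1 bhat s ->
  (forall j, j \notin equicorrelation rho -> b j 0 = 0) ->
  (forall j, j \in equicorrelation rho -> 0 <= rho j 0 * b j 0) ->
  least_squares X y s <= least_squares X y b.
Proof.
move=> rho [s0 [_ smin]] b0 rb.
have := smin (subvec (equicorrelation rho) b).
rewrite /least_squares !subcols_mul_subvec //; apply=> k.
by rewrite ![subvec _ _ _ _]mxE; apply/rb/enum_valP.
Qed.

Lemma equicorrelation_sqr (R : realType) (p : nat) (rho : 'cV[R]_p) j :
  j \in equicorrelation rho -> rho j 0 * rho j 0 = 1.
Proof. by rewrite inE => /eqP rj; rewrite -expr2 -real_normK ?num_real // rj expr1n. Qed.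

Lemma sls_refitting_sign (R : realType) (n p : nat) (X : 'M[R]_(n, p))
    (y : 'cV[R]_n) (lambda1 : R) (bhat s : 'cV[R]_p) (j : 'I_p) :
  let rho := lasso_subgradient X y lambda1 bhat in
  sls_refitting X y lambda1 bhat s -> j \in equicorrelation rho ->
  0 <= rho j 0 * s j 0.
Proof.
move=> rho [_ [feas _]] jE.
by have := feas (enum_rank_in jE j); rewrite ![subvec _ _ _ _]mxE enum_rankK_in.
Qed.

(** The sign constraint is convex, so the whole segment from [s] to [s + h e_j] is feasible, and the
    derivative at its start cannot be negative. *)
Lemma sls_refitting_first_order (R : realType) (n p : nat)
    (X : 'M[R]_(n, p)) (y : 'cV[R]_n) (lambda1 : R) (bhat s : 'cV[R]_p)
    (j : 'I_p) (h : R) :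
  let rho := lasso_subgradient X y lambda1 bhat in
  sls_refitting X y lambda1 bhat s -> j \in equicorrelation rho ->
  0 <= rho j 0 * (s j 0 + h) ->
  0 <= least_squares_grad X y s j 0 * h.
Proof.
move=> rho hs jE feas; have [c Hc] := least_squares_expand_delta X y s j.
apply: (@linear_coef_ge0 _ _ (c * h ^+ 2)) => t t0 t1.
suff : least_squares X y s <= least_squares X y (s + (h * t) *: delta_mx j 0).
  by rewrite Hc; lra.
have sgn := @sls_refitting_sign _ _ _ _ _ _ _ _ _ hs.
have coordE i : (s + (h * t) *: delta_mx j 0) i 0 = s i 0 + h * t * (i == j)%:R.
  by rewrite !mxE andbT.
apply: (sls_refitting_min hs) => i iE; rewrite coordE.
  have /negPf -> : i != j by apply: contraNneq iE => ->.
  by rewrite (proj1 hs) // mulr0 addr0.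
have [ij|_] := eqVneq i j; last by rewrite mulr0 addr0 sgn.
have := sgn j jE; rewrite ij -/rho mulr1.
move: feas; set u := rho j 0; set v := s j 0 => feas sj.
have -> : u * (v + h * t) = t * (u * (v + h)) + (1 - t) * (u * v) by ring.
by rewrite addr_ge0 // mulr_ge0 // ?subr_ge0 // ltW.
Qed.

(** The step [h = rho_j] is feasible because [rho_j^2 = 1], and [h = - s_j] because it sends the
    coordinate to [0]. The latter gives [g_j s_j <= 0]; conversely [g_j s_j] is the product of
    [g_j rho_j] and [rho_j s_j], both nonnegative. *)
Lemma sls_refitting_kkt (R : realType) (n p : nat)
    (X : 'M[R]_(n, p)) (y : 'cV[R]_n) (lambda1 : R) (bhat s : 'cV[R]_p)
    (j : 'I_p) :
  let rho := lasso_subgradient X y lambda1 bhat in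
  let g := least_squares_grad X y s in
  sls_refitting X y lambda1 bhat s -> j \in equicorrelation rho ->
  0 <= g j 0 * rho j 0 /\ g j 0 * s j 0 = 0.
Proof.
move=> rho g hs jE.
have rr := equicorrelation_sqr jE; have sj := sls_refitting_sign hs jE.
have fo := @sls_refitting_first_order _ _ _ _ _ _ _ _ _ _ hs jE.
rewrite -/rho in rr sj fo.
have gr : 0 <= g j 0 * rho j 0 by apply: fo; rewrite mulrDr rr addr_ge0.
have gs : 0 <= g j 0 * - s j 0 by apply: fo; rewrite subrr mulr0.
split=> //; apply/eqP; rewrite eq_le -oppr_ge0 -mulrN gs /=.
have -> : g j 0 * s j 0 = (g j 0 * rho j 0) * (rho j 0 * s j 0).
  by rewrite mulrA -[g j 0 * rho j 0 * rho j 0]mulrA rr mulr1.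
exact: mulr_ge0.
Qed.

Theorem theorem6 (R : realType) (n p : nat) (lambda1 : R)
    (hlambda1 : 0 < lambda1) (y : 'cV[R]_n) (X : 'M[R]_(n, p))
    (bhat : 'cV[R]_p) (hbhat : lasso_solution X y lambda1 bhat)
    (bSLS : 'cV[R]_p) (hbSLS : sls_refitting X y lambda1 bhat bSLS) :
  exists lambda0 : R, 0 < lambda0 /\
    forall lambda2 : R, lambda0 <= lambda2 ->
      bregman_refitting X y lambda1 lambda2 bhat bSLS.
Proof.
set rho := lasso_subgradient X y lambda1 bhat.
pose g := least_squares_grad X y bSLS.
have rho1 j : `|rho j 0| <= 1 by exact: lasso_subgradient_le1.
(* On [E] the inverse below is [0^-1 = 0], so the summand is [|g_j|]. *)
pose thr j := `|g j 0| * (1 + (1 - `|rho j 0|)^-1).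
have thr0 j : 0 <= thr j.
  by rewrite mulr_ge0 // addr_ge0 // invr_ge0 subr_ge0.
(* The sum dominates every [thr j]; the added [1] keeps the bound positive when they all vanish. *)
exists (1 + \sum_j thr j); split; first by rewrite ltr_wpDr ?sumr_ge0.
move=> lambda2 hl.
have thr_le j : thr j <= lambda2.
  apply: le_trans hl; rewrite (bigD1 j) //=.
  have : 0 <= \sum_(i | i != j) thr i by rewrite sumr_ge0.
  lra.
have coord (b : 'cV[R]_p) j : 0 <= g j 0 * (b j 0 - bSLS j 0)
    + lambda2 * ((`|b j 0| - rho j 0 * b j 0)
                 - (`|bSLS j 0| - rho j 0 * bSLS j 0)).
  have := thr_le j; rewrite /thr => tj.
  have gb := ler_norm (- (g j 0 * b j 0)); rewrite normrN normrM in gb.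
  have g0 := normr_ge0 (g j 0); have b0 := normr_ge0 (b j 0).
  have [jE|jE] := boolP (j \in equicorrelation rho).
    have [gr gs] := sls_refitting_kkt hbSLS jE.
    have sj := sls_refitting_sign hbSLS jE.
    have rr := equicorrelation_sqr jE; rewrite -/rho -/g in gr gs sj rr.
    move: jE; rewrite inE => /eqP rE; rewrite rE subrr invr0 addr0 mulr1 in tj.
    have -> : `|bSLS j 0| = rho j 0 * bSLS j 0.
      by rewrite -(ger0_norm sj) normrM rE mul1r.
    have babs : `|b j 0| = `|rho j 0 * b j 0| by rewrite normrM rE mul1r.
    rewrite subrr subr0 mulrBr gs subr0.
    (* If [b_j] has the sign of [rho_j] or is zero, the penalty vanishes and [g_j b_j >= 0].
       Otherwise the penalty is at least [lambda2 |b_j|], which absorbs [g_j b_j]. *)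
    have [rb|rb] := lerP 0 (rho j 0 * b j 0).
      rewrite babs ger0_norm // subrr mulr0 addr0.
      have -> : g j 0 * b j 0 = (g j 0 * rho j 0) * (rho j 0 * b j 0).
        by rewrite mulrA -[g j 0 * rho j 0 * rho j 0]mulrA rr mulr1.
      exact: mulr_ge0.
    have : `|g j 0| * `|b j 0| <= lambda2 * `|b j 0| by exact: ler_wpM2r.
    have : 0 <= lambda2 * - (rho j 0 * b j 0).
      by rewrite mulr_ge0 ?(le_trans g0 tj) // oppr_ge0 ltW.
    lra.
  (* Off [E], [|rho_j| < 1], so [|b_j| - rho_j b_j >= (1 - |rho_j|) |b_j|] with a positive
     factor. *)
  have -> : bSLS j 0 = 0 by exact: (proj1 hbSLS).
  rewrite normr0 mulr0 !subr0.
  have q0 : 0 < 1 - `|rho j 0|.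
    by rewrite subr_gt0 lt_neqAle rho1 andbT; move: jE; rewrite inE.
  have l20 : 0 <= lambda2 by apply: le_trans tj; exact: thr0.
  have gl : `|g j 0| <= lambda2 * (1 - `|rho j 0|).
    rewrite -ler_pdivrMr //; apply: le_trans tj.
    by rewrite mulrDr mulr1 lerDr.
  have rb := ler_norm (rho j 0 * b j 0); rewrite normrM in rb.
  have := ler_wpM2r b0 gl; have := ler_wpM2l l20 rb; lra.
split=> // b _.
have -> : b = bSLS + (b - bSLS) by rewrite addrC subrK.
set d := b - bSLS.
have := least_squares_gradient_le X y bSLS d.
suff : 0 <= inner g d + lambda2 *
    (bregman_div rho (bSLS + d) bhat - bregman_div rho bSLS bhat).
  by rewrite -/g -/rho; lra.
(* The terms in [bhat] cancel, and the difference of the divergences separates over coordinates. *)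
have -> : bregman_div rho (bSLS + d) bhat - bregman_div rho bSLS bhat =
    \sum_j ((`|b j 0| - rho j 0 * b j 0)
            - (`|bSLS j 0| - rho j 0 * bSLS j 0)).
  have -> : bSLS + d = b by rewrite addrC subrK.
  have innerB (w : 'cV[R]_p) :
      inner rho (w - bhat) = inner rho w - inner rho bhat.
    by rewrite /inner -sumrB; apply: eq_bigr => j _; rewrite !mxE mulrBr.
  by rewrite /bregman_div !innerB !sumrB -/(norm1 _) -/(inner _ _)
    /norm1 /inner; lra.
rewrite mulr_sumr /inner -big_split sumr_ge0 // => j _ /=.
by have -> : d j 0 = b j 0 - bSLS j 0 by rewrite !mxE.
Qed.
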